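(* Let $p\in(0,1)$, $\epsilon>0$ with $a:=p(1+\epsilon)<1$, and $0\le\eta<\epsilon$, $b:=p(1+\eta)$. For $n\in\mathbb{N}$ let $e(n)=np(1+\epsilon)=na$, and let $X_0^e(n;b)=\mathbb{E}^{\mathbb{P}^b}[(D_1(n)-e(n))^+]$, where under $\mathbb{P}^b$ the random variable $D_1(n)$ is a sum of $n$ independent Bernoulli random variables with success probability $b$. Then $$X_0^e(n;b)\le (n-\lfloor e(n)\rfloor)\,e^{-nI_b(a)},$$ and $X_0^e(n;b)$ tends to zero exponentially fast as $n\to\infty$ (i.e. there are constants $C,c>0$ with $X_0^e(n;b)\le Ce^{-cn}$ for all $n$).
   Context: $\lfloor x\rfloor$ denotes the integer part of $x$. The rate function is $$I_b(a)=a\log\frac{a}{b}+(1-a)\log\frac{1-a}{1-b},\qquad a,b\in(0,1).$$ ($X_0^e(n;b)$ is the price of an excess-of-loss reinsurance contract on $n$ lives with excess $e(n)$ when the reinsurer uses death probability $b$; $D_1(n)$ is the number of deaths. In the inequality, the base $e$ of the exponential is Euler's number.) *)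

(* Defs.v *)
From HB Require Import structures.
From mathcomp Require Import all_boot all_order all_algebra.
From mathcomp Require Import all_classical all_reals all_analysis.

Set Implicit Arguments.
Unset Strict Implicit.
Unset Printing Implicit Defensive.

Import Order.TTheory GRing.Theory Num.Theory.
Import numFieldNormedType.Exports.

Local Open Scope classical_set_scope.
Local Open Scope ring_scope.

Definition mutually_independent (d d' : measure_display)
    (T : measurableType d) (T' : measurableType d') (R : realType)
    (P : probability T R) (I : finType) (X : I -> {RV P >-> T'}) : Prop :=
  forall (J : {set I}) (A : I -> set T'),
    (forall i, i \in J -> measurable (A i)) ->
    (P (\bigcap_(i in [set` J]) (X i @^-1` A i))
     = \prod_(i in J) P (X i @^-1` A i))%E.

(* The law of the real random variable X is the image of [bernoulli_prob b]
   under the embedding of bool as {0, 1}. The equality is only required on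
   Borel sets: a measure takes junk values on non-measurable ones. *)
Definition is_bernoulli (d : measure_display) (T : measurableType d)
    (R : realType) (P : probability T R) (b : R) (X : {RV P >-> R}) : Prop :=
  forall A : set R, measurable A ->
    distribution P X A
    = bernoulli_prob b ((fun c : bool => (c : nat)%:R : R) @^-1` A).

Definition rate (R : realType) (b a : R) : R :=
  a * ln (a / b) + (1 - a) * ln ((1 - a) / (1 - b)).

(* Expected reinsurance payment for the aggregate loss D with excess e;
   [f ^\+] is the positive part of f. *)
Definition excess_of_loss_price (d : measure_display) (T : measurableType d)
    (R : realType) (P : probability T R) (D : T -> R) (e : R) : \bar R :=
  'E_P[(fun w => D w - e)^\+].

(* Main.v *)
(** Chernoff's method. Almost surely [0 <= D <= n], so for every [t >= 0]
    [(D - n a)^+ <= (n - floor (n a)) expR (t (D - n a))]. Since each [X i] is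
    almost surely 0 or 1, [expR (t D)] is the product of the
    [1 + (expR t - 1) 1_{X i = 1}]; expanding it over subsets of indices and
    using independence gives the moment generating function
    [(1 + (expR t - 1) b) ^+ n]. The choice [expR t = a (1 - b) / (b (1 - a))]
    produces the rate function, which is positive as [a != b]. *)
Require Import Defs.
From HB Require Import structures.
From mathcomp Require Import all_boot all_order all_algebra.
From mathcomp Require Import all_classical all_reals all_analysis.
From mathcomp Require Import measurable_realfun ring lra.

Set Implicit Arguments.
Unset Strict Implicit.
Unset Printing Implicit Defensive.

Import Order.TTheory GRing.Theory Num.Theory.
Import numFieldNormedType.Exports.

Local Open Scope classical_set_scope.
Local Open Scope ring_scope.

Lemma ln_lt_sub1 (R : realType) (x : R) : 0 < x -> x != 1 -> ln x < x - 1.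
Proof.
move=> x0 x1; have lnx0 : ln x != 0 by rewrite ln_eq0.
by have := expR_gt1Dx lnx0; rewrite lnK ?posrE//; lra.
Qed.

(** Gibbs' inequality for the relative entropy of two Bernoulli laws: the strict bound
    [ln x < x - 1], applied to the inverted ratios [b / a] and [(1 - b) / (1 - a)], bounds the two
    summands by [b - a] and [a - b], which cancel. *)
Lemma rate_gt0 (R : realType) (a b : R) :
  0 < a < 1 -> 0 < b < 1 -> a != b -> 0 < rate b a.
Proof.
move=> /andP[a0 a1] /andP[b0 b1] ab.
have a1' : 0 < 1 - a by lra.
have b1' : 0 < 1 - b by lra.
have h1 : ln (b / a) < b / a - 1.
  apply: ln_lt_sub1; first exact: divr_gt0.
  by apply: contra_neq ab => /divr1_eq.
have h2 : ln ((1 - b) / (1 - a)) < (1 - b) / (1 - a) - 1.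
  apply: ln_lt_sub1; first exact: divr_gt0.
  by apply: contra_neq ab => /divr1_eq; lra.
have -> : rate b a = - (a * ln (b / a) + (1 - a) * ln ((1 - b) / (1 - a))).
  by rewrite /rate !ln_div ?posrE//; ring.
rewrite oppr_gt0.
have h3 : a * ln (b / a) < b - a.
  have -> : b - a = a * (b / a - 1) by field; rewrite gt_eqF.
  by rewrite ltr_pM2l.
have h4 : (1 - a) * ln ((1 - b) / (1 - a)) < a - b.
  have -> : a - b = (1 - a) * ((1 - b) / (1 - a) - 1).
    by field; rewrite gt_eqF.
  by rewrite ltr_pM2l.
lra.
Qed.

(** Here [ln s] is the minimiser of the Chernoff exponent; at this value the one-step factor
    [1 + (s - 1) * b] collapses to [(1 - b) / (1 - a)]. *)
Lemma chernoff_optimal_tilt (R : realType) (n : nat) (a b : R) :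
  0 < a < 1 -> 0 < b < 1 ->
  let s := a * (1 - b) / (b * (1 - a)) in
  (1 + (s - 1) * b) ^+ n * expR (- (ln s * (n%:R * a)))
  = expR (- (n%:R * rate b a)).
Proof.
move=> /andP[a0 a1] /andP[b0 b1] s.
have a1' : 0 < 1 - a by lra.
have b1' : 0 < 1 - b by lra.
have -> : 1 + (s - 1) * b = expR (ln ((1 - b) / (1 - a))).
  by rewrite lnK ?posrE ?divr_gt0// /s; field; rewrite !gt_eqF.
rewrite -expRM_natl -expRD; congr expR.
rewrite /rate /s !ln_div ?posrE ?mulr_gt0// !lnM ?posrE//; ring.
Qed.

Section bernoulli_variables.
Context d (T : measurableType d) (R : realType) (P : probability T R).
Variables (b : R) (b01 : 0 <= b <= 1).

Lemma is_bernoulli_eq1 (X : {RV P >-> R}) : is_bernoulli b X ->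
  P (X @^-1` [set 1]) = b%:E.
Proof.
move=> hX; have := hX [set 1] (measurable_set1 _).
rewrite bernoulli_probE// !diracE mem_set//= memNset/=.
  by rewrite mule1 mule0 adde0.
by move=> /esym/eqP; rewrite oner_eq0.
Qed.

(** The complement of [{0, 1}] is Borel and is missed by both Dirac masses, so its preimage is a
    null set. *)
Lemma is_bernoulli_ae01 (X : {RV P >-> R}) : is_bernoulli b X ->
  {ae P, forall w, X w = 0 \/ X w = 1}.
Proof.
move=> hX; have m01 : measurable (~` [set 0; 1] : set R).
  by apply: measurableC; apply: measurableU; exact: measurable_set1.
exists (X @^-1` ~` [set 0; 1]); split.
- exact: measurable_funPTI.
- have := hX _ m01; rewrite bernoulli_probE// !diracE !memNset/=.
  + by rewrite !mule0 adde0.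
  + by apply; left.
  + by apply; right.
- by move=> w h hw; apply: h.
Qed.

Variables (I : finType) (X : I -> {RV P >-> R}).
Hypothesis hbern : forall i, is_bernoulli b (X i).
Hypothesis hind : mutually_independent X.

(** Indicators replace [expR (t * X i w)] so that the expansion over subsets is an identity at every
    point. The sign of [r] makes all terms nonnegative, hence sum and integral commute without any
    integrability argument. *)
Lemma integral_prod_bernoulli (r : R) : 0 <= r ->
  (\int[P]_w (\prod_(i : I) (1 + r * \1_(X i @^-1` [set 1%R]) w))%:E
   = ((1 + r * b) ^+ #|I|)%:E)%E.
Proof.
move=> r0.
pose A (J : {set I}) := \bigcap_(i in [set` J]) (X i @^-1` [set 1%R]).
have mX i : measurable (X i @^-1` [set 1%R]).
  exact: measurable_funPTI.
have mA J : measurable (A J).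
  by apply: fin_bigcap_measurable => // i _.
have PA J : (P (A J) = (b ^+ #|J|)%:E)%E.
  rewrite (hind (A := fun=> [set 1%R]))//.
  under eq_bigr do rewrite is_bernoulli_eq1//.
  by rewrite prodEFin prodr_const.
have expand w : \prod_(i : I) (1 + r * \1_(X i @^-1` [set 1%R]) w)
    = \sum_(J : {set I}) r ^+ #|J| * \1_(A J) w.
  under eq_bigr do rewrite addrC.
  rewrite bigA_distr; apply: eq_bigr => J _.
  rewrite -big_mkcond/= big_split/= prodr_const; congr (_ * _).
  rewrite indicE; case: (boolP (w \in A J)) => /=.
    rewrite inE => AJw; rewrite big1// => i iJ.
    by rewrite indicE mem_set//; exact: AJw.
  (* Contrapositive: a nonzero product of indicators has no zero factor, so [w] lies in each event
     indexed by [J]. *)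
  apply: contraNeq => /prodf_neq0 h; rewrite inE => i /= iJ.
  by have := h i iJ; rewrite indicE pnatr_eq0 eqb0 negbK inE.
under eq_integral do rewrite expand -sumEFin.
rewrite ge0_integral_sum//=; last 2 first.
- move=> J; apply/measurable_EFinP/measurable_funM => //.
- by move=> J w _; rewrite lee_fin mulr_ge0 ?exprn_ge0.
have intJ (J : {set I}) :
    (\int[P]_w (r ^+ #|J| * \1_(A J) w)%:E = ((r * b) ^+ #|J|)%:E)%E.
  under eq_integral do rewrite EFinM.
  rewrite ge0_integralZl_EFin//=; last 2 first.
  - exact/measurable_EFinP.
  - exact: exprn_ge0.
  by rewrite integral_indic// setIT exprMn EFinM -PA.
under eq_bigr do rewrite intJ.
rewrite sumEFin; congr EFin.
(* The same subset expansion, applied to the constant factors [1 + r * b], matches the sum term by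
   term. *)
rewrite -prodr_const; under [RHS]eq_bigr do rewrite addrC.
rewrite bigA_distr; apply: eq_bigr => J _.
by rewrite -big_mkcond/= prodr_const.
Qed.

End bernoulli_variables.

(** When [x > y], the exponential is at least 1 and [x - y <= n - floor y]; otherwise the left side
    is 0 and the right side is nonnegative because [floor y <= y <= n]. *)
Lemma excess_le_exp (R : realType) (n : nat) (x y t : R) :
  0 <= t -> x <= n%:R -> y <= n%:R ->
  Num.max (x - y) 0 <= (n%:R - (Num.floor y)%:~R) * expR (t * (x - y)).
Proof.
move=> t0 xn yn; have fy : (Num.floor y)%:~R <= y by exact: floor_le.
have fn : 0 <= n%:R - (Num.floor y)%:~R :> R by lra.
have [xy|xy] := leP (x - y) 0; first by rewrite mulr_ge0 ?expR_ge0.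
rewrite -[leLHS]mulr1 ler_pM//; [exact: ltW|lra|].
by rewrite -expR0 ler_expR mulr_ge0 ?(ltW xy).
Qed.

Lemma excess_of_loss_price_le d (T : measurableType d) (R : realType)
    (P : probability T R) (n : nat) (X : 'I_n -> {RV P >-> R}) (a b : R) :
  0 < a < 1 -> 0 < b < 1 -> b <= a ->
  (forall i, is_bernoulli b (X i)) -> mutually_independent X ->
  (excess_of_loss_price P (fun w => (\sum_(i < n) X i w)%R) (n%:R * a)%R
   <= ((n%:R - (Num.floor (n%:R * a))%:~R)
       * expR (- (n%:R * rate b a)))%:E)%E.
Proof.
move=> a01 b01 ba hb hi.
have [/andP[a0 a1] /andP[b0 b1]] := (a01, b01).
have b01' : 0 <= b <= 1 by lra.
pose s := a * (1 - b) / (b * (1 - a)).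
(* The hypothesis [b <= a] enters here: it makes the tilt [ln s] nonnegative, as well as the
   coefficient [s - 1] in [G]. *)
have s1 : 1 <= s.
  by rewrite /s ler_pdivlMr ?mul1r; [nra|rewrite mulr_gt0; lra].
have s0 : 0 < s by lra.
have nan : n%:R * a <= n%:R by rewrite ler_piMr// ltW.
pose K := n%:R - (Num.floor (n%:R * a))%:~R : R.
have K0 : 0 <= K by have := floor_le (n%:R * a); rewrite /K; lra.
pose c := K * expR (- (ln s * (n%:R * a))).
have c0 : 0 <= c by rewrite mulr_ge0 ?expR_ge0.
(* [G] is nonnegative everywhere and agrees almost surely with [expR (ln s * D)], where [D] is the
   sum of the [X i]. *)
pose G w := \prod_(i < n) (1 + (s - 1) * \1_(X i @^-1` [set 1%R]) w).
have G0 w : 0 <= G w.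
  by apply: prodr_ge0 => i _; rewrite addr_ge0 ?mulr_ge0//; lra.
have mX i : measurable (X i @^-1` [set 1%R]).
  exact: measurable_funPTI.
have mG : measurable_fun setT G.
  apply: measurable_prod => i _.
  by apply: measurable_funD => //; apply: measurable_funM.
have IG : (\int[P]_w (G w)%:E = ((1 + (s - 1) * b) ^+ n)%:E)%E.
  by rewrite (integral_prod_bernoulli b01' hb hi) ?card_ord//; lra.
(* Once the bound is itself an integral, it remains to compare the integrands almost everywhere. *)
have -> : (K * expR (- (n%:R * rate b a)))%:E
    = (\int[P]_w (c * G w)%:E)%E.
  under eq_integral do rewrite EFinM.
  rewrite ge0_integralZl_EFin//; last 2 first.
  - by move=> w _; rewrite lee_fin.
  - exact/measurable_EFinP.
  rewrite IG -EFinM -(chernoff_optimal_tilt n a01 b01) -/s /c.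
  by congr EFin; ring.
rewrite /excess_of_loss_price unlock.
apply: ae_ge0_le_integral => //.
- by move=> w _; rewrite lee_fin funrpos_ge0.
- apply/measurable_EFinP/measurable_funrpos/measurable_funB => //.
  exact: measurable_sum.
- by move=> w _; rewrite lee_fin mulr_ge0.
- by apply/measurable_EFinP/measurable_funM.
have : {ae P, forall w, forall i, X i w = 0 \/ X i w = 1}.
  by apply: filter_forall => i; exact: is_bernoulli_ae01 (hb i).
apply: filterS => w hw _; rewrite lee_fin.
have Gw : G w = expR (ln s * \sum_(i < n) X i w).
  rewrite mulr_sumr expR_sum; apply: eq_bigr => i _; rewrite indicE.
  case: (hw i) => Xi.
    by rewrite memNset /= Xi ?mulr0 ?expR0 ?addr0// => /esym/eqP; rewrite oner_eq0.
  by rewrite mem_set//= Xi !mulr1 lnK ?posrE//; ring.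
have Dn : \sum_(i < n) X i w <= n%:R.
  rewrite -[leRHS]mulr1 -[n in leRHS]card_ord mulr_natl -sumr_const.
  by apply: ler_sum => i _; case: (hw i) => ->.
apply: le_trans (excess_le_exp (ln_ge0 s1) Dn nan) _.
by rewrite Gw /c mulrBr expRD -mulrA -/K [expR _ * _]mulrC.
Qed.

Theorem proposition6p3 (R : realType) (p eps eta a b : R) (e : nat -> R)
    (hp : 0 < p < 1) (heps : 0 < eps)
    (ha : a = p * (1 + eps)) (ha1 : a < 1)
    (heta : 0 <= eta < eps) (hb : b = p * (1 + eta))
    (he : forall n : nat, e n = n%:R * a)
    (d : nat -> measure_display) (T : forall n : nat, measurableType (d n))
    (P : forall n : nat, probability (T n) R)
    (X : forall n : nat, 'I_n -> {RV (P n) >-> R})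
    (hbern : forall (n : nat) (i : 'I_n), is_bernoulli b (X n i))
    (hind : forall n : nat, mutually_independent (X n))
    (D1 : forall n : nat, T n -> R)
    (hD1 : forall (n : nat) (w : T n), D1 n w = \sum_(i < n) X n i w) :
  (forall n : nat,
     (excess_of_loss_price (P n) (D1 n) (e n)
      <= ((n%:R - (Num.floor (e n))%:~R) * expR (- (n%:R * rate b a)))%:E)%E)
  /\ exists C c : R, [/\ 0 < C, 0 < c &
       forall n : nat,
         (excess_of_loss_price (P n) (D1 n) (e n)
          <= (C * expR (- (c * n%:R)))%:E)%E].
Proof.
have [[/andP[p0 p1] /andP[eta0 etaeps]]] := (hp, heta).
have ba : b < a by rewrite ha hb ltr_pM2l//; lra.
have b0 : 0 < b by rewrite hb mulr_gt0//; lra.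
have a01 : 0 < a < 1 by lra.
have b01 : 0 < b < 1 by lra.
have bound (n : nat) : (excess_of_loss_price (P n) (D1 n) (e n)
    <= ((n%:R - (Num.floor (e n))%:~R) * expR (- (n%:R * rate b a)))%:E)%E.
  have -> : D1 n = fun w => \sum_(i < n) X n i w by apply/funext => w.
  by rewrite he; exact: excess_of_loss_price_le a01 b01 (ltW ba) _ _.
split=> //.
have r0 : 0 < rate b a by apply: rate_gt0 => //; rewrite gt_eqF.
(* Half of the rate is kept as the decay; the other half absorbs the linear prefactor. With
   [r = rate b a], the constant is chosen so that [(1 + 2 / r) * (1 + r / 2 * n) >= n + 1], and
   [1 + x <= expR x] concludes. *)
exists (1 + 2 / rate b a), (rate b a / 2); split; [|lra|].
  by rewrite addr_gt0 ?divr_gt0.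
move=> n; apply: le_trans (bound n) _; rewrite lee_fin.
have nE : n%:R * rate b a = rate b a / 2 * n%:R + rate b a / 2 * n%:R by field.
rewrite nE opprD expRD mulrA ler_wpM2r ?expR_ge0// expRN ler_pdivrMr ?expR_gt0//.
have fl : n%:R - (Num.floor (e n))%:~R <= n%:R + 1 :> R.
  have : 0 <= e n by rewrite he mulr_ge0//; lra.
  by rewrite -floor_ge0 -(ler_int R); lra.
have ex := expR_ge1Dx (rate b a / 2 * n%:R).
apply: le_trans fl _.
apply: (@le_trans _ _ ((1 + 2 / rate b a) * (1 + rate b a / 2 * n%:R))); last first.
  by rewrite ler_wpM2l// ltW// addr_gt0 ?divr_gt0.
have -> : (1 + 2 / rate b a) * (1 + rate b a / 2 * n%:R)
    = 1 + n%:R + (2 / rate b a + rate b a / 2 * n%:R).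
  by field; rewrite gt_eqF.
have : 0 <= 2 / rate b a + rate b a / 2 * n%:R.
  by rewrite addr_ge0 ?mulr_ge0 ?invr_ge0 ?(ltW r0).
lra.
Qed.
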